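(* There exists an absolute constant $c>0$ with the following property. Let $q$ be a prime power, let $s$ be a positive integer, and let $\mathcal{A}=\{a_1(x)+\langle d_1(x)\rangle,\ldots,a_n(x)+\langle d_n(x)\rangle\}$ be a finite collection of arithmetic progressions in $\mathbb{F}_q[x]$, where $a_i(x),d_i(x)\in\mathbb{F}_q[x]$, each $d_i(x)$ is monic with $\deg d_i(x)\geq 1$, and $\langle d_i(x)\rangle=d_i(x)\mathbb{F}_q[x]$. Suppose that $\mathcal{A}$ is a covering system of $\mathbb{F}_q[x]$, i.e. $\mathbb{F}_q[x]=\bigcup_{i=1}^n\big(a_i(x)+\langle d_i(x)\rangle\big)$, and that $\mathcal{A}$ has multiplicity $s$, i.e. $$\max_{d(x)\in\mathbb{F}_q[x]}\#\{1\leq i\leq n: d_i(x)=d(x)\}=s.$$ Then $$\min_{1\leq i\leq n}\deg d_i(x)\leq 3\,(c+3\log_q s)\,\log\!\big(cs+3s\log_q s\big).$$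
   Context: $\mathbb{F}_q$ denotes the finite field with $q$ elements, $\log$ is the natural logarithm and $\log_q$ the logarithm to base $q$. The constant $c$ does not depend on $q$, $s$, or $\mathcal{A}$. *)

(* Defs.v *)
From HB Require Import structures.
From mathcomp Require Import all_boot all_order all_algebra.
From mathcomp Require Import classical_sets reals exp.

Set Implicit Arguments.
Unset Strict Implicit.
Unset Printing Implicit Defensive.

Import Order.TTheory GRing.Theory Num.Theory.

Local Open Scope ring_scope.
Local Open Scope classical_set_scope.

(* [pdeg 0 = 0]; only applied to monic polynomials. *)
Definition pdeg (F : fieldType) (p : {poly F}) : nat := (size p).-1.

Definition arith_prog (F : fieldType) (a d : {poly F}) : set {poly F} :=
  [set a + d * g | g in [set: {poly F}]].

Definition covering_system (F : fieldType) (n : nat)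
    (a d : 'I_n -> {poly F}) : Prop :=
  [set: {poly F}] = \bigcup_(i in [set: 'I_n]) arith_prog (a i) (d i).

Definition has_multiplicity (F : fieldType) (n : nat)
    (d : 'I_n -> {poly F}) (s : nat) : Prop :=
  (exists D : {poly F}, #|[pred i | d i == D]| = s) /\
  (forall D : {poly F}, (#|[pred i | d i == D]| <= s)%N).

(* Starting the iterated [minn] at the largest degree makes this the true
   minimum as soon as [0 < n]; a covering system always has [0 < n]. *)
Definition min_deg (F : fieldType) (n : nat) (d : 'I_n -> {poly F}) : nat :=
  \big[minn / (\max_(i < n) pdeg (d i))%N]_(i < n) pdeg (d i).

Definition logb (R : realType) (b x : R) : R := ln x / ln b.

(* Main.v *)
Require Import Defs.
From HB Require Import structures.
From mathcomp Require Import all_boot all_order all_algebra.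
From mathcomp Require Import qpoly qfpoly finfield zify ring lra.
From mathcomp Require Import classical_sets reals sequences exp.

(* The distortion method of Balister, Bollobas, Morris, Sahasrabudhe and Tiba.
   Let p_0, p_1, ... be the monic irreducibles ordered by degree.  By the Chinese
   remainder theorem a residue class modulo d is a box in the product of the rings
   F[X]/p_j^D.  The coordinates are revealed one at a time and the uniform measure is
   distorted along the way: if the boxes whose last nontrivial coordinate is i cover
   less than half of a fibre, that part of the fibre is erased and the rest rescaled,
   at a cost of a factor at most 2; otherwise nothing is done.  Step i then adds at
   most min(E[alpha], 2 E[alpha^2]) to the covered mass, alpha being the covered
   proportion of the fibre, and no covering exists if these terms sum to less than 1.

   The terms are controlled by Mertens-type bounds which follow from the fact that
   there are at most q^d/d monic irreducibles of degree d.  For irreducibles of degree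
   at most k, first moments and Rankin's trick with the parameter u = e^(1/k) bound the
   total by O(s k^2 e^(-N/k)), where N is the least degree of a modulus.  For the others,
   second moments bound it by O(s^2 (5/(4q))^k).  With k = 3 log_q s + O(1) the second
   total is less than 1/4, and so is the first if N > 3 k log(s k). *)

Set Implicit Arguments.
Unset Strict Implicit.
Unset Printing Implicit Defensive.

Import Order.TTheory GRing.Theory Num.Theory.

Local Open Scope ring_scope.

(** * Arithmetic of polynomials over a finite field *)

Section PolynomialArithmetic.
Variable F : finFieldType.
Implicit Types p q r : {poly F}.

Definition monic_irreducible p := (p \is monic) && irreducibleb p.

Lemma monic_irreducible_gt1 p : monic_irreducible p -> (1 < size p)%N.
Proof. by case/andP=> _ /irreducibleP []. Qed.

Lemma monic_irreducible_coprime p q :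
  monic_irreducible p -> monic_irreducible q -> p != q -> coprimep p q.
Proof.
move=> /andP[pm /irreducibleP pI] /andP[qm /irreducibleP [_ qP]].
rewrite irreducible_poly_coprime //; apply: contraNN => pq.
have p1 : size p != 1%N by rewrite gtn_eqF //; case: pI.
by have := qP _ p1 pq; rewrite eqp_monic.
Qed.

Lemma monic_irreducible_divisor q :
  q \is monic -> (1 < size q)%N ->
  exists2 p, monic_irreducible p & p %| q.
Proof.
have [k] := ubnP (size q); elim: k q => // k IHk q lek qm q1.
have q0 : q != 0 by rewrite monic_neq0.
have [qI|] := boolP (irreducibleb q); first by exists q => //; apply/andP.
rewrite /irreducibleb q1 /= negb_forall => /existsP[[r /= rs]].
rewrite negb_imply -ltnNge -Pdiv.Idomain.dvdpE => /andP[rq r1].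
have r0 : r != 0 by rewrite -size_poly_gt0 ltnW.
have lc0 : (lead_coef r)^-1 != 0 by rewrite invr_eq0 lead_coef_eq0.
have [||| p pI pr] := IHk ((lead_coef r)^-1 *: r).
- rewrite size_scale // (leq_ltn_trans rs) // -ltnS prednK // (ltn_trans _ q1) //.
- by rewrite monicE lead_coefZ mulVf // lead_coef_eq0.
- by rewrite size_scale.
exists p => //; apply: dvdp_trans pr _.
by rewrite dvdpZl.
Qed.

(** Sorting by degree makes the primes of degree at most any cut-off an initial segment of the list,
    so that small primes are revealed before large ones. *)
Definition primes_upto D : seq {poly F} :=
  sort (relpre (fun p => size (p : {poly F})) leq)
    [seq p <- [seq polyn y | y : {poly_D.+1 F}] | monic_irreducible p].

Lemma primes_upto_uniq D : uniq (primes_upto D).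
Proof.
rewrite sort_uniq filter_uniq // map_inj_uniq ?enum_uniq //.
exact: val_inj.
Qed.

Lemma mem_primes_upto D p :
  (p \in primes_upto D) = monic_irreducible p && (size p <= D.+1)%N.
Proof.
rewrite mem_sort mem_filter; congr (_ && _).
apply/mapP/idP => [[x _ ->]|sp]; first exact: size_npoly.
by exists (NPoly sp); rewrite ?mem_enum.
Qed.

Lemma primes_upto_sorted D i j :
  (i <= j < size (primes_upto D))%N ->
  (size (nth 0%R (primes_upto D) i) <= size (nth 0%R (primes_upto D) j))%N.
Proof.
move=> /andP[ij jD].
set r := relpre (fun p : {poly F} => size p) leq.
have tr : transitive r by move=> x y z /=; apply: leq_trans.
have rf : reflexive r by move=> x /=.
have srt : sorted r (primes_upto D) by apply: sort_sorted => x y; apply: leq_total.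
exact: (sorted_leq_nth tr rf 0 srt i j (leq_ltn_trans ij jD) jD ij).
Qed.

Lemma monic_factorization D q :
  q \is monic -> (size q <= D.+1)%N ->
  exists e : nat -> nat,
    q = \prod_(j < size (primes_upto D)) (primes_upto D)`_j ^+ e j.
Proof.
have [k] := ubnP (size q); elim: k q => // k IHk q lek qm qD.
have [q1|q1] := leqP (size q) 1.
  exists (fun=> 0%N); rewrite big1; last by move=> i _; rewrite expr0.
  apply/eqP; rewrite -eqp_monic ?monic1 // -size_poly_eq1 eqn_leq q1.
  by rewrite size_poly_gt0 monic_neq0.
have [p pI /dvdpP[r qE]] := monic_irreducible_divisor qm q1.
have pm : p \is monic by case/andP: pI.
have rm : r \is monic by rewrite -(monicMr _ pm) -qE.
have sE : size q = (size r + size p).-1.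
  by rewrite qE size_mul ?monic_neq0.
have p1 := monic_irreducible_gt1 pI.
have r0 : (0 < size r)%N by rewrite size_poly_gt0 monic_neq0.
have [||| e rE] := IHk r.
- by rewrite -ltnS (leq_trans _ lek) // ltnS sE; case: (size p) p1 => [|[|n]] // _; rewrite !addnS /= ltnS leq_addr.
- by [].
- by apply: leq_trans qD; rewrite sE; case: (size p) p1 => [|[|n]] // _; rewrite !addnS /= -addnS leq_addr.
have pD : (size p <= D.+1)%N.
  by apply: leq_trans qD; rewrite sE; case: (size r) r0 => // n _; rewrite addSn /= leq_addl.
have pP : p \in primes_upto D by rewrite mem_primes_upto pI.
have ip : (index p (primes_upto D) < size (primes_upto D))%N by rewrite index_mem.
exists (fun j => e j + (j == index p (primes_upto D)))%N.
rewrite qE {1}rE (bigD1 (Ordinal ip)) //= [RHS](bigD1 (Ordinal ip)) //=.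
rewrite eqxx addn1 exprS nth_index // mulrC mulrA; congr (_ * _).
apply: eq_bigr => i ni; have -> : (i == index p (primes_upto D) :> nat) = false.
  by apply/negP => /eqP ie; case/eqP: ni; apply/val_inj.
by rewrite addn0.
Qed.

(* Every element of the field [F[X]/p] is fixed by [x |-> x^(q^d)]. *)
Lemma monic_irreducible_dvd_XqX p d :
  monic_irreducible p -> size p = d.+1 -> p %| 'X^(#|F| ^ d) - 'X.
Proof.
move=> /andP[pm /irreducibleP pI] sp.
have hI : monic_irreducible_poly p by split.
have := expf_card (in_qpoly p 'X : {poly %/ p with hI}).
rewrite card_qfpoly sp /= => /(congr1 val) /= e.
have mk : mk_monic p = p by rewrite mk_monicE.
have {e} : 'X^(#|F| ^ d) %% p = 'X %% p.
  move: e; rewrite (poly_of_qpolyX (in_qpoly p 'X : {poly %/ p})) /= mk.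
  by rewrite Pdiv.RingMonic.rmodpX // !Pdiv.IdomainMonic.modpE.
by move=> e; rewrite /dvdp modpD modpN e subrr.
Qed.

Lemma coprime_prod_dvd (s : seq {poly F}) r :
  uniq s -> all monic_irreducible s -> all (fun p => p %| r) s ->
  \prod_(p <- s) p %| r.
Proof.
elim: s => [|p s IHs] /=; first by rewrite big_nil dvd1p.
move=> /andP[ps us] /andP[pI sI] /andP[pr sr].
rewrite big_cons Gauss_dvdp ?pr ?IHs //.
elim: s ps sI {us sr IHs} => [|x s IHs] /=; first by rewrite big_nil coprimep1.
rewrite inE negb_or => /andP[px ps] /andP[xI sI].
by rewrite big_cons coprimepMr monic_irreducible_coprime //= IHs.
Qed.

Lemma size_prod_same (s : seq {poly F}) d :
  all (fun p => size p == d.+1) s ->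
  size (\prod_(p <- s) p) = (size s * d).+1.
Proof.
elim: s => [|p s IHs] /=; first by rewrite big_nil size_poly1.
move=> /andP[/eqP sp ss]; have sI := IHs ss.
rewrite big_cons size_mul -?size_poly_gt0 ?sp ?sI //.
by rewrite addSn addnS /= mulSn.
Qed.

(** Distinct monic irreducibles of degree [d] are coprime divisors of [X^(q^d) - X]; hence their
    product divides it, and degrees are compared. *)
Lemma count_monic_irreducible (s : seq {poly F}) d :
  (0 < d)%N -> uniq s -> all monic_irreducible s ->
  all (fun p => size p == d.+1) s -> (size s * d <= #|F| ^ d)%N.
Proof.
move=> d0 us sI ss.
have q1 : (1 < #|F| ^ d)%N.
  by rewrite (leq_trans (finNzRing_gt1 F)) // -{1}(expn1 #|F|) leq_exp2l // finNzRing_gt1.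
have sXX : size ('X^(#|F| ^ d) - 'X : {poly F}) = (#|F| ^ d).+1.
  by rewrite size_polyDl ?size_polyXn // size_polyN size_polyX.
rewrite -ltnS -(size_prod_same ss) -sXX dvdp_leq //.
  by rewrite -size_poly_gt0 sXX.
apply: coprime_prod_dvd => //; apply/allP => p ps.
apply: monic_irreducible_dvd_XqX; first exact: (allP sI).
exact/eqP/(allP ss).
Qed.

(** By induction: given [u Q + v p_m^M = 1], adding [(y_m - x) u Q] keeps the old residues and
    installs the new one. *)
Lemma chinese_remainder (p : nat -> {poly F}) (y : nat -> {poly F}) m M :
  (forall i j, (i < j < m)%N -> coprimep (p i) (p j)) ->
  exists x, forall j, (j < m)%N -> p j ^+ M %| x - y j.
Proof.
elim: m => [|m IHm] cop; first by exists 0.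
have [|x xP] := IHm.
  by move=> i j /andP[ij jm]; apply: cop; rewrite ij ltnS ltnW.
pose Q := \prod_(j < m) p j ^+ M.
have : coprimep Q (p m ^+ M).
  apply: (big_ind (fun Q => coprimep Q (p m ^+ M))).
  - exact: coprime1p.
  - by move=> a b; rewrite coprimepMl => -> ->.
  - by move=> i _; apply/coprimep_expl/coprimep_expr/cop; rewrite ltn_ord leqnn.
move=> /Bezout_eq1_coprimepP [[u v] /= uv].
exists (x + (y m - x) * (u * Q)) => j; rewrite ltnS leq_eqVlt => /predU1P[->|jm].
  have -> : x + (y m - x) * (u * Q) - y m = (x - y m) * v * p m ^+ M.
    have -> : u * Q = 1 - v * p m ^+ M by rewrite -uv addrK.
    by ring.
  exact: dvdp_mull.
rewrite addrAC dvdp_add ?xP // dvdp_mull // dvdp_mull //.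
by rewrite /Q (bigD1 (Ordinal jm)) //= dvdp_mulr.
Qed.

(** Two members of a class with the same quotient by [p] coincide, and that quotient has at most
    [D - deg p] coefficients. *)
Lemma card_residue_class D p r :
  p != 0 -> (size p <= D.+1)%N ->
  (#|[pred y : {poly_D F} | (p %| val y - r)%R]| <= #|F| ^ (D - (size p).-1))%N.
Proof.
move=> p0 pD; set k := (D - _)%N.
rewrite -(@card_npoly F k).
have key (y : {poly_D F}) : (size (val y %/ p)%R <= k)%N.
  by rewrite size_divp // /k leq_sub2r // size_npoly.
pose h (y : {poly_D F}) : {poly_k F} := NPoly (key y).
rewrite -(@card_in_imset _ _ h).
  by apply: subset_leq_card; apply/fintype.subsetP.
move=> x y; rewrite !inE => px py /(congr1 val) /= e.
apply/val_inj; rewrite /= (divp_eq (val x) p) (divp_eq (val y) p) e; congr (_ + _).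
apply/eqP; rewrite -subr_eq0 -modpN -modpD -[_ == 0]/(p %| _).
by rewrite -[val x](subrK r) -addrA -[r - _]opprB dvdp_sub.
Qed.

End PolynomialArithmetic.

(** * Distorted measures *)

Section Distortion.
Variables (R : realFieldType) (X : finType).
Hypothesis X_gt0 : (0 < #|X|)%N.
Implicit Types (f h : seq X -> R) (x : seq X) (y : X).

Definition avg (f : X -> R) : R := (\sum_y f y) / #|X|%:R.

Lemma avg_le (f h : X -> R) : (forall y, f y <= h y) -> avg f <= avg h.
Proof. by move=> fh; rewrite ler_wpM2r ?invr_ge0 ?ler0n // ler_sum. Qed.

Lemma eq_avg (f h : X -> R) : f =1 h -> avg f = avg h.
Proof. by move=> fh; congr (_ / _); apply: eq_bigr => y _; apply: fh. Qed.

Lemma avgD (f h : X -> R) : avg (fun y => f y + h y) = avg f + avg h.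
Proof. by rewrite /avg big_split mulrDl. Qed.

Lemma avgZ c (f : X -> R) : avg (fun y => c * f y) = c * avg f.
Proof. by rewrite /avg -mulr_sumr mulrA. Qed.

Lemma avg_cst c : avg (fun=> c) = c.
Proof.
by rewrite /avg sumr_const -[c *+ _]mulr_natr mulfK // pnatr_eq0 -lt0n.
Qed.

Lemma avg_ge0 (f : X -> R) : (forall y, 0 <= f y) -> 0 <= avg f.
Proof. by move=> f0; rewrite -(avg_cst 0) avg_le. Qed.

Lemma avg_sum (I : Type) (r : seq I) (P : pred I) (f : I -> X -> R) :
  avg (fun y => \sum_(i <- r | P i) f i y) = \sum_(i <- r | P i) avg (f i).
Proof. by rewrite /avg exchange_big /= mulr_suml. Qed.

(* A sequence [y :: x] lists the coordinates of a partial point in reverse order: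
   [y] is the coordinate of index [size x].  [bad (y :: x)] says that the point is
   covered by a progression whose last nontrivial coordinate is [size x]. *)
Variable bad : seq X -> bool.

Definition bad_density x : R := avg (fun y => (bad (y :: x))%:R).

(** Density of the distorted measure in the new coordinate, given the past [x]. The threshold one
    half keeps the rescaling factor at most 2. *)
Definition weight x y : R :=
  if bad_density x < 2^-1 then (~~ bad (y :: x))%:R / (1 - bad_density x) else 1.

(** Expectation under the distorted measure on points with [i] coordinates; the latest coordinate is
    integrated out first. *)
Fixpoint dexp i f : R :=
  if i is j.+1 then dexp j (fun x => avg (fun y => weight x y * f (y :: x)))
  else f [::].

Definition hit x : R := avg (fun y => weight x y * (bad (y :: x))%:R).

(** Counts the bad prefixes of a point; being integer-valued, it vanishes once it is below 1. *)
Fixpoint badness x : R :=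
  if x is y :: x' then (bad x)%:R + badness x' else 0.

Lemma bad_density_ge0 x : 0 <= bad_density x.
Proof. by apply: avg_ge0 => y; rewrite ler0n. Qed.

Lemma weight_ge0 x y : 0 <= weight x y.
Proof.
rewrite /weight; case: ifP => // lt2; rewrite divr_ge0 ?ler0n //; lra.
Qed.

Lemma weight_le2 x y : weight x y <= 2.
Proof.
rewrite /weight; case: ifP => [lt2|_]; last by rewrite ler1n.
have h : 0 < 1 - bad_density x by lra.
rewrite ler_pdivrMr //; case: (bad _) => /=; lra.
Qed.

Lemma avg_weight x : avg (weight x) = 1.
Proof.
rewrite /weight; case: ltP => [lt2|_]; last exact: avg_cst.
rewrite (eq_avg (h := fun y => (1 - bad_density x)^-1 * (1 + -1 * (bad (y :: x))%:R))).
  by rewrite avgZ avgD avg_cst avgZ mulN1r mulVf //; lra.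
by move=> y; case: (bad _) => /=; rewrite mulrC; congr (_ * _); lra.
Qed.

Lemma hitE x : hit x = if bad_density x < 2^-1 then 0 else bad_density x.
Proof.
rewrite /hit /weight; case: ltP => _; last by apply: eq_avg => y; rewrite mul1r.
rewrite -[RHS]avg_cst; apply: eq_avg => y.
by case: (bad _); rewrite /= ?mul0r ?mulr0.
Qed.

Lemma hit_le x : hit x <= bad_density x.
Proof. by rewrite hitE; case: ifP => // _; apply: bad_density_ge0. Qed.

(** Nothing is hit when the density [alpha] is below 1/2, and otherwise [alpha <= 2 alpha^2]. *)
Lemma hit_le_sqr x : hit x <= 2 * bad_density x ^+ 2.
Proof.
rewrite hitE; have := bad_density_ge0 x; case: ltP => h; nra.
Qed.

Lemma dexp_le i f h :
  (forall x, size x = i -> f x <= h x) -> dexp i f <= dexp i h.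
Proof.
elim: i f h => [|i IHi] f h fh /=; first exact: fh.
apply: IHi => x sx; apply: avg_le => y.
by rewrite ler_wpM2l ?weight_ge0 ?fh //= sx.
Qed.

Lemma eq_dexp i f h :
  (forall x, size x = i -> f x = h x) -> dexp i f = dexp i h.
Proof. by move=> fh; apply/le_anti/andP; split; apply: dexp_le => x /fh ->. Qed.

Lemma dexpD i f h : dexp i (fun x => f x + h x) = dexp i f + dexp i h.
Proof.
elim: i f h => [//|i IHi] f h /=; rewrite -IHi; apply: eq_dexp => x _.
by rewrite -avgD; apply: eq_avg => y; rewrite mulrDr.
Qed.

Lemma dexpZ i c f : dexp i (fun x => c * f x) = c * dexp i f.
Proof.
elim: i f => [//|i IHi] f /=; rewrite -IHi; apply: eq_dexp => x _.
by rewrite -avgZ; apply: eq_avg => y; rewrite mulrCA.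
Qed.

(** Consistency of the successive measures: the weights average to 1, so later distortions do not
    change the law of earlier coordinates. *)
Lemma dexp_lift i f : dexp i.+1 (fun x => f (behead x)) = dexp i f.
Proof.
rewrite /=; apply: eq_dexp => x _.
rewrite (eq_avg (h := fun y => f x * weight x y)); last by move=> y; rewrite mulrC.
by rewrite avgZ avg_weight mulr1.
Qed.

Lemma dexp_cst i c : dexp i (fun=> c) = c.
Proof. by elim: i => [//|i IHi]; rewrite -[RHS]IHi; apply: (dexp_lift i (fun=> c)). Qed.

Lemma dexp_sum i (I : Type) (r : seq I) (P : pred I) (f : I -> seq X -> R) :
  dexp i (fun x => \sum_(j <- r | P j) f j x) = \sum_(j <- r | P j) dexp i (f j).
Proof.
elim: r => [|j r IHr].
  by rewrite big_nil -[RHS](dexp_cst i); apply: eq_dexp => x _; rewrite big_nil.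
rewrite big_cons; case: ifP => Pj; last first.
  by rewrite -IHr; apply: eq_dexp => x _; rewrite big_cons Pj.
by rewrite -IHr -dexpD; apply: eq_dexp => x _; rewrite big_cons Pj.
Qed.

Lemma dexp_badness m : dexp m badness = \sum_(i < m) dexp i hit.
Proof.
elim: m => [|m IHm]; first by rewrite big_ord0.
rewrite big_ord_recr /= -IHm -(dexp_lift m badness) addrC /hit /= -dexpD.
by apply: eq_dexp => x _; rewrite -avgD; apply: eq_avg => y; rewrite mulrDr.
Qed.

Lemma badness_lt1_not_bad x : badness x < 1 ->
  forall k, (k < size x)%N -> ~~ bad (drop k x).
Proof.
have badness_ge0 z : 0 <= badness z.
  by elim: z => [//|y z IHz] /=; rewrite addr_ge0.
elim: x => [//|y x IHx] /= lt1 [_|k kx].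
  by move: lt1 (badness_ge0 x); case: (bad _) => //= ? ?; lra.
by apply: IHx => //; apply: le_lt_trans lt1; rewrite lerDr.
Qed.

(** First-moment argument: the sum is the expected number of bad prefixes, so some point has fewer
    than one. *)
Lemma exists_not_bad m : \sum_(i < m) dexp i hit < 1 ->
  exists2 x, size x = m & forall k, (k < size x)%N -> ~~ bad (drop k x).
Proof.
rewrite -dexp_badness => lt1.
suff [x sx bx] : exists2 x, size x = m & badness x < 1.
  by exists x => //; apply: badness_lt1_not_bad.
have [/existsP[t bt]|] := boolP [exists t : m.-tuple X, badness t < 1].
  by exists t => //; rewrite size_tuple.
rewrite negb_exists => /forallP nb; move: lt1; rewrite ltNge => /negP[].
rewrite -[leLHS](dexp_cst m); apply: dexp_le => x /eqP sx.
by have := nb (Tuple sx); rewrite -leNgt.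
Qed.

Fixpoint boxf (f : nat -> X -> R) x : R :=
  if x is y :: x' then f (size x') y * boxf f x' else 1.

Lemma boxf_ge0 (f : nat -> X -> R) x : (forall j y, 0 <= f j y) -> 0 <= boxf f x.
Proof. by move=> f0; elim: x => [//|y x IHx] /=; rewrite mulr_ge0. Qed.

Lemma boxfM (f h : nat -> X -> R) x : boxf f x * boxf h x = boxf (fun j y => f j y * h j y) x.
Proof. by elim: x => [|y x /= <-]; rewrite ?mul1r // mulrACA. Qed.

(** A coordinate left free by the box costs nothing, as the weights average to 1; only the others
    pay the factor 2 of the distortion. *)
Lemma dexp_boxf i (f : nat -> X -> R) (kappa : nat -> R) :
  (forall j y, 0 <= f j y) ->
  (forall j, (j < i)%N -> ((forall y, f j y = 1) /\ kappa j = 1) \/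
                          2 * avg (f j) <= kappa j) ->
  dexp i (boxf f) <= \prod_(j < i) kappa j.
Proof.
move=> f0; elim: i => [|i IHi] fk; first by rewrite big_ord0.
have favg0 : 0 <= avg (f i) by apply: avg_ge0.
have k0 : 0 <= kappa i by case: (fk i (leqnn _)) => [[_ ->] //|]; apply: le_trans; lra.
have IH : dexp i (boxf f) <= \prod_(j < i) kappa j.
  by apply: IHi => j ji; apply: fk; rewrite ltnS ltnW.
rewrite big_ord_recr /= mulrC; apply: le_trans (ler_wpM2l k0 IH).
rewrite -dexpZ; apply: dexp_le => x sx; rewrite sx.
have bx := boxf_ge0 x f0.
case: (fk i (leqnn _)) => [[f1 ->]|fi].
  rewrite (eq_avg (h := fun y => boxf f x * weight x y)); last first.
    by move=> y; rewrite f1 mul1r mulrC.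
  by rewrite avgZ avg_weight mul1r mulr1.
apply: (@le_trans _ _ (avg (fun y => (2 * boxf f x) * f i y))).
  apply: avg_le => y; rewrite [f i y * _]mulrC mulrA ler_wpM2r //.
  by rewrite ler_wpM2r // weight_le2.
by rewrite avgZ mulrAC ler_wpM2r.
Qed.

End Distortion.

(** * Moments of the covered mass *)

(** Replaces a sum over progressions by a sum over exponent vectors; this is where the multiplicity
    enters. *)
Lemma sum_fibers_le (R : realFieldType) (T Y : finType) (P : pred T) (H : T -> Y)
    (G : Y -> R) (s : nat) :
  (forall y, 0 <= G y) ->
  (forall t, P t -> (#|[pred u | P u && (H u == H t)]| <= s)%N) ->
  \sum_(t | P t) G (H t) <= s%:R * \sum_y G y.
Proof.
move=> G0 Hs; rewrite (partition_big H xpredT) //= mulr_sumr; apply: ler_sum => y _.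
rewrite (eq_bigr (fun=> G y)) => [|t /andP[_ /eqP ->] //].
rewrite sumr_const -[G y *+ _]mulr_natl ler_wpM2r // ler_nat.
have [/existsP[t /andP[Pt /eqP <-]]|/existsPn no] := boolP [exists t, P t && (H t == y)].
  exact: Hs.
by rewrite (eq_card0 (A := _)) // => t; apply/negbTE; exact: no.
Qed.

Section Boxes.
Variables (R : realFieldType) (X : finType).
Hypothesis X_gt0 : (0 < #|X|)%N.
Variables (T : finType) (m s gamma : nat).
(** For a progression [t], [e t j] is the exponent of the [j]-th prime in the modulus, [b t j] the
    condition on coordinate [j], and [top t] the last coordinate with a nonzero exponent. Below,
    [rho j] stands for the inverse norm of the prime. *)
Variables (e : T -> nat -> nat) (b : T -> nat -> X -> bool) (top : T -> nat).
Variable rho : nat -> R.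
Hypothesis rho_ge0 : forall j, 0 <= rho j.
Hypothesis b_full : forall t j y, e t j = 0%N -> b t j y.
Hypothesis b_avg : forall t j, (j < m)%N ->
  avg (fun y => (b t j y)%:R) <= rho j ^+ e t j.
Hypothesis e_top : forall t, (0 < e t (top t))%N.
Hypothesis e_after : forall t j, (top t < j < m)%N -> e t j = 0%N.
Hypothesis e_le : forall t j, (j < m)%N -> (e t j <= gamma)%N.
Hypothesis mult : forall t, (#|[pred u | [forall j : 'I_m, e u j == e t j]]| <= s)%N.

Fixpoint in_box t (x : seq X) : bool :=
  if x is y :: x' then b t (size x') y && in_box t x' else true.

Definition covered (z : seq X) : bool :=
  if z is y :: x then [exists t, (top t == size x) && in_box t z] else false.

Let ind t j y : R := (b t j y)%:R.

(** Price, under the distorted measure, of a condition modulo the [a]-th power of the [j]-th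
    prime. *)
Definition local_factor j a : R := if a == 0%N then 1 else 2 * rho j ^+ a.

Lemma in_boxE t x : (in_box t x)%:R = boxf (ind t) x.
Proof. by elim: x => [//|y x IHx] /=; rewrite -IHx -natrM mulnb. Qed.

Lemma ind_ge0 t j y : 0 <= ind t j y. Proof. exact: ler0n. Qed.

Lemma local_factor_ge0 j a : 0 <= local_factor j a.
Proof. by rewrite /local_factor; case: ifP => // _; rewrite mulr_ge0 ?exprn_ge0. Qed.

(** Union bound over the progressions ending at [i] whose earlier conditions hold at [x]. *)
Lemma covered_density_le i x : (i < m)%N -> size x = i ->
  bad_density R covered x <= \sum_(t | top t == i) rho i ^+ e t i * boxf (ind t) x.
Proof.
move=> im sx.
apply: (@le_trans _ _ (avg (fun y => \sum_(t | top t == i) boxf (ind t) x * ind t i y))).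
  apply: avg_le => // y; rewrite /covered sx.
  have t0 t : 0 <= boxf (ind t) x * ind t i y.
    by rewrite mulr_ge0 ?boxf_ge0 ?ind_ge0 // => j z; apply: ind_ge0.
  case: existsP => [[t /andP[ti tx]]|_]; last by rewrite sumr_ge0.
  rewrite (bigD1 t) //= -[leLHS]addr0 lerD ?sumr_ge0 //.
  by move: tx; rewrite /= sx -in_boxE /ind => /andP[-> ->]; rewrite mulr1.
rewrite avg_sum; apply: ler_sum => t _.
rewrite avgZ mulrC ler_wpM2r ?b_avg // boxf_ge0 // => j z; exact: ind_ge0.
Qed.

Lemma hit_first_moment i : (i < m)%N ->
  dexp covered i (hit R covered) <=
  \sum_(t | top t == i) rho i ^+ e t i * \prod_(j < i) local_factor j (e t j).
Proof.
move=> im.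
apply: (@le_trans _ _ (dexp covered i
    (fun x => \sum_(t | top t == i) rho i ^+ e t i * boxf (ind t) x))).
  apply: dexp_le => // x sx; apply: le_trans (hit_le R X_gt0 _ _) _.
  exact: covered_density_le.
rewrite dexp_sum //; apply: ler_sum => t _; rewrite dexpZ // ler_wpM2l ?exprn_ge0 //.
apply: (dexp_boxf X_gt0 _ (kappa := fun j => local_factor j (e t j))) =>
  [j y|j ji]; first exact: ind_ge0.
rewrite /local_factor; case: eqP => [e0|_].
  by left; split => // y; rewrite /ind b_full.
by right; rewrite ler_wpM2l ?b_avg // (ltn_trans ji).
Qed.

(** The square of the union bound runs over pairs of progressions. At each earlier prime the joint
    condition is at most as likely as the one with the larger exponent, whence [maxn]. *)
Lemma hit_second_moment i : (i < m)%N ->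
  dexp covered i (hit R covered) <=
  2 * \sum_(tu : T * T | (top tu.1 == i) && (top tu.2 == i))
    rho i ^+ e tu.1 i * rho i ^+ e tu.2 i *
      \prod_(j < i) local_factor j (maxn (e tu.1 j) (e tu.2 j)).
Proof.
move=> im.
have boxf0 t x : 0 <= boxf (ind t) x by rewrite boxf_ge0 // => j z; apply: ind_ge0.
apply: (@le_trans _ _ (dexp covered i (fun x => 2 *
    \sum_(tu : T * T | (top tu.1 == i) && (top tu.2 == i))
      rho i ^+ e tu.1 i * rho i ^+ e tu.2 i *
      boxf (fun j y => ind tu.1 j y * ind tu.2 j y) x))).
  apply: dexp_le => // x sx; apply: le_trans (hit_le_sqr R X_gt0 _ _) _.
  rewrite ler_wpM2l //.
  have le := covered_density_le im sx; have ge0 := bad_density_ge0 R X_gt0 covered x.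
  apply: le_trans (_ : (\sum_(t | top t == i) rho i ^+ e t i * boxf (ind t) x) ^+ 2 <= _).
    by rewrite lerXn2r // nnegrE // (le_trans ge0).
  rewrite expr2 big_distrlr pair_big /=; apply: ler_sum => -[t u] /= _.
  by rewrite -boxfM mulrACA.
rewrite dexpZ // ler_wpM2l // dexp_sum //; apply: ler_sum => -[t u] /= _.
rewrite dexpZ // ler_wpM2l ?mulr_ge0 ?exprn_ge0 //.
apply: (dexp_boxf X_gt0 _ (kappa := fun j => local_factor j (maxn (e t j) (e u j)))) =>
  [j y|j ji]; first by rewrite mulr_ge0 ?ind_ge0.
rewrite /local_factor; case: eqP => [e0|_].
  have [t0 u0] : e t j = 0%N /\ e u j = 0%N.
    by split; apply/eqP; rewrite -leqn0 -e0 ?leq_maxl ?leq_maxr.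
  by left; split => // y; rewrite /ind !b_full // mulr1.
right; rewrite ler_wpM2l //; have jm := ltn_trans ji im.
have ind_le1 v y : ind v j y <= 1 by rewrite /ind lern1 leq_b1.
by case: (leqP (e t j) (e u j)) => _; apply: le_trans (b_avg _ jm); apply: avg_le => // y;
  rewrite ?ler_piMr ?ler_piMl ?ind_ge0.
Qed.

Lemma same_box_card P t : {subset P <= [pred u | [forall j : 'I_m, e u j == e t j]]} ->
  (#|P : {pred T}| <= s)%N.
Proof. by move=> sub; apply: leq_trans (mult t); apply/subset_leq_card/fintype.subsetP. Qed.

(* Rankin's trick: the weight [prod_j v j ^+ e t j / V >= 1] is inserted in the union bound. *)
Lemma small_hits (J : nat) (v : nat -> R) (V : R) :
  (J <= m)%N -> 0 < V -> (forall j, 0 <= v j) ->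
  (forall t, V <= \prod_(j < m) v j ^+ e t j) ->
  \sum_(i < J) dexp covered i (hit R covered) <=
  V^-1 * (s%:R * \prod_(j < J) \sum_(a < gamma.+1) local_factor j a * v j ^+ a).
Proof.
move=> Jm V0 v0 Vle.
pose w j a := local_factor j a * v j ^+ a.
have w0 j a : 0 <= w j a by rewrite mulr_ge0 ?exprn_ge0 ?local_factor_ge0.
(* Giving up a factor 2 at the top coordinate makes all factors uniform; coordinates after the top
   contribute 1. *)
apply: (@le_trans _ _ (\sum_(i < J) \sum_(t | top t == i) \prod_(j < J) local_factor j (e t j))).
  apply: ler_sum => i _; have im : (i < m)%N by apply: leq_trans Jm.
  apply: le_trans (hit_first_moment im) _; apply: ler_sum => t /eqP ti.
  rewrite -[leRHS](big_mkord xpredT (fun j => local_factor j (e t j)))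
    [leRHS](big_cat_nat (n := i)) ?(ltnW (ltn_ord i)) //=.
  rewrite big_mkord mulrC ler_wpM2l ?prodr_ge0 // => [? _|]; first exact: local_factor_ge0.
  rewrite big_ltn // big_nat big1 => [|j /andP[ij jJ]]; last first.
    by rewrite /local_factor e_after // ti ij (leq_trans jJ).
  rewrite mulr1 /local_factor -ti eqn0Ngt e_top /= ler_peMl ?exprn_ge0 //; lra.
rewrite (exchange_big_dep (fun t => (top t < J)%N)) /=; last by move=> i t _ /eqP ->.
apply: (@le_trans _ _ (V^-1 * \sum_(t | (top t < J)%N) \prod_(j < J) w j (e t j))).
  rewrite mulr_sumr; apply: ler_sum => t tJ.
  rewrite (big_pred1 (Ordinal tJ)) => [|i]; last by rewrite /= -val_eqE eq_sym.
  rewrite big_split /= mulrC -mulrA ler_peMr ?prodr_ge0 // => [? _|]; first exact: local_factor_ge0.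
  rewrite ler_pdivlMr // mul1r; apply: le_trans (Vle t) _.
  rewrite -(big_mkord xpredT (fun j => v j ^+ e t j)) (big_cat_nat (n := J)) //= big_mkord.
  rewrite [X in _ * X]big_nat [X in _ * X]big1 ?mulr1 // => j /andP[Jj jm].
  by rewrite e_after ?expr0 // jm (leq_trans tJ).
(* The Euler product expands into a sum over exponent vectors. [inord] below loses nothing, since
   exponents are at most [gamma]. *)
rewrite ler_wpM2l ?invr_ge0 ?(ltW V0) // bigA_distr_bigA /=.
pose H t : {ffun 'I_J -> 'I_gamma.+1} := [ffun j : 'I_J => inord (e t j)].
have HE t (j : 'I_J) : (H t j : nat) = e t j.
  by rewrite ffunE inordK // ltnS e_le // (leq_trans (ltn_ord j)).
rewrite (eq_bigr (fun t => \prod_(j < J) w j (H t j))) => [|t _]; last first.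
  by apply: eq_bigr => j _; rewrite HE.
apply: (@sum_fibers_le R T _ _ H (fun f : {ffun 'I_J -> 'I_gamma.+1} => \prod_(j < J) w j (f j))) =>
  [f|t tJ].
  by apply: prodr_ge0.
apply: (@same_box_card _ t) => u; rewrite !inE => /andP[uJ /eqP Hut].
apply/forallP => j; have [jJ|Jj] := ltnP j J.
  by have := HE u (Ordinal jJ); rewrite Hut HE /= => ->.
by rewrite !e_after // ltn_ord (leq_trans _ Jj).
Qed.

(** A pair of exponent vectors comes from at most [s^2] pairs of progressions, and the sum over all
    such pairs factors over the primes; at [i] both exponents are nonzero. *)
Lemma large_hit i : (i < m)%N ->
  dexp covered i (hit R covered) <=
  2 * (s%:R ^+ 2 * ((\sum_(a < gamma.+1 | a != 0%N :> nat) rho i ^+ a) ^+ 2 *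
    \prod_(j < i) \sum_(a < gamma.+1) \sum_(c < gamma.+1) local_factor j (maxn a c))).
Proof.
move=> im; apply: le_trans (hit_second_moment im) _; rewrite ler_wpM2l //.
pose Y : finType := ('I_gamma.+1 * 'I_gamma.+1)%type.
(* The value 0 discards pairs with a zero exponent at [i], so the sum may run over all functions. *)
pose f j (y : Y) : R := if (j == i) then
  (if (y.1 != 0%N :> nat) && (y.2 != 0%N :> nat) then rho i ^+ y.1 * rho i ^+ y.2 else 0)
  else local_factor j (maxn y.1 y.2).
have f0 j y : 0 <= f j y.
  by rewrite /f; case: ifP => _; [case: ifP => _ //; rewrite mulr_ge0 ?exprn_ge0|exact: local_factor_ge0].
have -> : (\sum_(a < gamma.+1 | a != 0%N :> nat) rho i ^+ a) ^+ 2 *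
    \prod_(j < i) \sum_(a < gamma.+1) \sum_(c < gamma.+1) local_factor j (maxn a c) =
    \sum_(h : {ffun 'I_i.+1 -> Y}) \prod_(j < i.+1) f j (h j).
  rewrite -(bigA_distr_bigA (fun (j : 'I_i.+1) y => f j y)) big_ord_recr /= mulrC; congr (_ * _).
    apply: eq_bigr => j _; rewrite pair_big; apply: eq_bigr => y _.
    by rewrite /f ltn_eqF.
  rewrite expr2 big_distrlr pair_big big_mkcond /=; apply: eq_bigr => y _.
  by rewrite /f eqxx.
pose H (tu : T * T) : {ffun 'I_i.+1 -> Y} :=
  [ffun j : 'I_i.+1 => (inord (e tu.1 j), inord (e tu.2 j))].
have jm (j : 'I_i.+1) : (j < m)%N by apply: leq_trans im.
have HE tu (j : 'I_i.+1) : ((H tu j).1 : nat) = e tu.1 j /\ ((H tu j).2 : nat) = e tu.2 j.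
  by rewrite ffunE /= !inordK ?ltnS ?e_le.
rewrite (eq_bigr (fun tu => \prod_(j < i.+1) f j (H tu j))) => [|[t u] /= /andP[/eqP ti /eqP ui]]; last first.
  rewrite big_ord_recr /= mulrC; congr (_ * _).
    apply: eq_bigr => j _.
    have [] := HE (t, u) (widen_ord (leqnSn i) j).
    by rewrite /f /= => -> ->; rewrite ltn_eqF.
  have [] := HE (t, u) ord_max; rewrite /f /= eqxx => -> ->.
  by rewrite -!lt0n; have := e_top t; rewrite ti => ->; have := e_top u; rewrite ui => ->.
rewrite -natrX.
apply: (@sum_fibers_le R _ _ _ H (fun h => \prod_(j < i.+1) f j (h j))) => [h|[t u] /= /andP[/eqP ti /eqP ui]].
  by apply: prodr_ge0.
pose A t := [pred v | [forall j : 'I_m, e v j == e t j]].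
apply: (@leq_trans #|[predX A t & A u]|); last first.
  by rewrite cardX -mulnn leq_mul // mult.
apply/subset_leq_card/fintype.subsetP => -[t' u'] /=;
rewrite !inE /= => /andP[/andP[/eqP ti' /eqP ui'] /eqP E].
have key (j : 'I_m) : (e t' j == e t j) && (e u' j == e u j).
  have [ji|ij] := leqP j i.
    have := HE (t', u') (Ordinal (ji : j < i.+1)%N).
    by rewrite E; have [/= -> ->] := HE (t, u) (Ordinal (ji : j < i.+1)%N) => -[-> ->]; rewrite !eqxx.
  by rewrite !e_after ?eqxx // ?ti ?ui ?ti' ?ui' ij ltn_ord.
by apply/andP; split; apply/forallP => j; case/andP: (key j).
Qed.

End Boxes.

(** * Elementary estimates *)

Section Elementary.
Variable R : realType.
Implicit Types x y rho : R.

Lemma geometric_sum_le n y : 0 <= y -> y < 1 -> \sum_(a < n) y ^+ a <= (1 - y)^-1.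
Proof.
move=> y0 y1; have h : 0 < 1 - y by rewrite subr_gt0.
rewrite -[leRHS]mul1r ler_pdivlMr // mulrC -opprB mulNr -subrX1 opprB.
by rewrite gerBl exprn_ge0.
Qed.

Lemma harmonic_le (K : nat) : (0 < K)%N ->
  \sum_(1 <= d < K.+1) (d%:R^-1 : R) <= 1 + ln K%:R.
Proof.
case: K => // K _; elim: K => [|K IHK]; first by rewrite big_nat1 invr1 ln1 addr0.
rewrite big_nat_recr //=; apply: le_trans (lerD IHK (lexx _)) _.
rewrite -addrA lerD2l -lerBrDl.
have K1 : 0 < K.+1%:R :> R by rewrite ltr0n.
have K2 : 0 < K.+2%:R :> R by rewrite ltr0n.
(* This is [ln (1 + x) <= x] at [x = -1/(K+2)], where [1 + x = (K+1)/(K+2)]. *)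
have := @le_ln1Dx R (- K.+2%:R^-1).
have -> : 1 + - K.+2%:R^-1 = K.+1%:R / K.+2%:R :> R.
  have -> : K.+1%:R = K.+2%:R - 1 :> R by rewrite -[K.+2%:R]natr1 addrK.
  by have := lt0r_neq0 K2; move: (K.+2%:R : R) => z z0; field.
  by rewrite ln_div ?posrE // ltrN2 invf_lt1 // ltr1n => /(_ isT) => h; rewrite -[leRHS]opprB lerNr.
Qed.

Lemma expR_sub1_le x : expR x - 1 <= x * expR x.
Proof.
have := expR_ge1Dx (- x); rewrite expRN => h.
have e0 := expR_gt0 x.
have : (1 + - x) * expR x <= 1 by rewrite -ler_pdivlMr // mul1r.
by nra.
Qed.

(** Follows from [x <= e^x] at [x = d ln(5/4) / n]. The base 5/4 is small enough that its quotient
    by any [q >= 2] is at most 5/8. *)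
Lemma power_le_exponential n : exists2 C : R, 0 < C &
  forall d : nat, d%:R ^+ n <= C * (5 / 4) ^+ d.
Proof.
case: n => [|n].
  by exists 1 => // d; rewrite expr0 mul1r exprn_ege1 //; lra.
pose L : R := ln (5 / 4).
have L0 : 0 < L by rewrite ln_gt0 //; lra.
have n0 : 0 < n.+1%:R :> R by rewrite ltr0n.
exists ((n.+1%:R / L) ^+ n.+1) => [|d]; first by rewrite exprn_gt0 ?divr_gt0.
have -> : (5 / 4) ^+ d = expR (d%:R * L / n.+1%:R) ^+ n.+1 :> R.
  rewrite -expRM_natl mulrCA mulfV ?gt_eqF // mulr1 expRM_natl lnK // posrE; lra.
rewrite -exprMn lerXn2r ?nnegrE // ?mulr_ge0 ?expR_ge0 ?invr_ge0 ?(ltW L0) //.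
rewrite mulrC -ler_pdivrMr ?divr_gt0 // invf_div mulrA.
by apply: le_trans (expR_ge1Dx _); rewrite lerDr.
Qed.

(** Exactly [2a + 1] pairs of naturals have maximum [a]. *)
Lemma sum_max n (f : nat -> R) :
  \sum_(a < n) \sum_(c < n) f (maxn a c) = \sum_(a < n) (a.*2.+1)%:R * f a.
Proof.
elim: n => [|n IHn]; first by rewrite !big_ord0.
rewrite big_ord_recr [RHS]big_ord_recr /= -IHn.
under eq_bigr do rewrite big_ord_recr /=.
rewrite big_split /= -addrA; congr (_ + _).
rewrite (eq_bigr (fun=> f n)) => [|i _]; last by rewrite (maxn_idPr _) // ltnW.
rewrite big_ord_recr /= maxnn [X in _ + (X + _)](eq_bigr (fun=> f n)) => [|i _]; last first.
  by rewrite (maxn_idPl _) // ltnW.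
rewrite !sumr_const card_ord -[RHS]mulrC -[in RHS]natr1 -muln2 natrM -[X in X + (X + _)]mulr_natl; ring.
Qed.

End Elementary.

(** * Bounds for single Euler factors *)

Section LocalFactors.
Variables (R : realType) (rho : nat -> R) (gamma j : nat).
Hypothesis rho_ge0 : 0 <= rho j.

Lemma local_factor_weighted_le (v : R) : 0 <= v -> rho j * v <= 5 / 8 ->
  \sum_(a < gamma.+1) local_factor rho j a * v ^+ a <=
  expR (2 * (rho j * v) + 6 * (rho j * v) ^+ 2).
Proof.
move=> v0 y1; set y := rho j * v in y1 *.
have y0 : 0 <= y by rewrite mulr_ge0.
apply: le_trans (expR_ge1Dx _).
rewrite big_ord_recl /local_factor /= expr0 mulr1 lerD2l.
rewrite (eq_bigr (fun a : 'I_gamma => 2 * y * y ^+ a)) => [|a _]; last first.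
  by rewrite /bump add1n -mulrA -exprMn -/y exprS mulrA.
rewrite -mulr_sumr.
have yl : y < 1 by lra.
have := geometric_sum_le gamma y0 yl; set S := \sum_(_ < _) _ => SE.
(* Here [(1 + 3y)(1 - y) >= 1] because [y <= 2/3]. *)
have h : (1 - y)^-1 <= 1 + 3 * y.
  by rewrite -[leLHS]mul1r ler_pdivrMr; [nra|lra].
have {}SE := le_trans SE h.
have : y * S <= y * (1 + 3 * y) by rewrite ler_wpM2l.
by nra.
Qed.

(** Since [2a + 1 <= 3 (5/3)^(a-1)] for [a >= 1], the nontrivial terms are dominated by a geometric
    series with first term [6 rho] and ratio at most 5/6, whence 36. *)
Lemma local_factor_pair_le : rho j <= 1 / 2 ->
  \sum_(a < gamma.+1) \sum_(c < gamma.+1) local_factor rho j (maxn a c) <=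
  expR (36 * rho j).
Proof.
move=> r2; apply: le_trans (expR_ge1Dx _).
rewrite sum_max big_ord_recl /local_factor /= mul1r lerD2l.
apply: (@le_trans _ _ (\sum_(a < gamma) 6 * rho j * (5 / 3 * rho j) ^+ a)).
  apply: ler_sum => a _; rewrite /bump add1n exprS.
  have -> : 6 * rho j * (5 / 3 * rho j) ^+ a = 3 * (5 / 3) ^+ a * (2 * (rho j * rho j ^+ a)).
    by rewrite exprMn; ring.
  rewrite ler_wpM2r ?mulr_ge0 ?exprn_ge0 //.
  have oddE k : (k.+1.*2.+1)%:R = 2 * k%:R + 3 :> R.
    by rewrite doubleS -!natr1 -addnn natrD; lra.
  rewrite oddE; elim: (nat_of_ord a) => [|n IHn]; first by rewrite expr0; lra.
  have p0 : 0 <= (5 / 3 : R) ^+ n by rewrite exprn_ge0 //; lra.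
  have n0 : 0 <= n%:R :> R by rewrite ler0n.
  by rewrite exprS -[n.+1%:R]natr1; move: ((5 / 3) ^+ n) n%:R p0 n0 IHn => P z; lra.
rewrite -mulr_sumr.
have y0 : 0 <= 5 / 3 * rho j by have r0 := rho_ge0; lra.
have y1 : 5 / 3 * rho j < 1 by lra.
have := geometric_sum_le gamma y0 y1; set S := \sum_(_ < _) _ => SE.
have h : (1 - 5 / 3 * rho j)^-1 <= 6.
  by rewrite -[leLHS]mul1r ler_pdivrMr; lra.
have {}SE := le_trans SE h.
have : rho j * S <= rho j * 6 by rewrite ler_wpM2l.
by lra.
Qed.

Lemma nontrivial_powers_le : rho j <= 1 / 2 ->
  \sum_(a < gamma.+1 | a != 0%N :> nat) rho j ^+ a <= 2 * rho j.
Proof.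
move=> r2; rewrite big_mkcond big_ord_recl /= add0r.
rewrite (eq_bigr (fun a : 'I_gamma => rho j * rho j ^+ a)) => [|a _]; last first.
  by rewrite /bump add1n exprS.
rewrite -mulr_sumr mulrC ler_wpM2r //.
have r1 : rho j < 1 by lra.
apply: le_trans (geometric_sum_le gamma rho_ge0 r1) _.
by rewrite -[leLHS]mul1r ler_pdivrMr; lra.
Qed.

End LocalFactors.

(** * Sums over irreducible polynomials *)

Section DegreeSums.
Variables (R : realType) (q m : nat) (delta : nat -> nat).
Hypothesis q_gt1 : (1 < q)%N.
Hypothesis delta_gt0 : forall j, (j < m)%N -> (0 < delta j)%N.
Hypothesis delta_mono : forall i j, (i <= j < m)%N -> (delta i <= delta j)%N.
Hypothesis delta_count : forall d, (0 < d)%N ->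
  (#|[pred j : 'I_m | delta j == d]| * d <= q ^ d)%N.

Let rho j : R := q%:R^-1 ^+ delta j.

Lemma q_ge2 : 2 <= q%:R :> R. Proof. by rewrite ler_nat. Qed.

Lemma rho_ge0 j : 0 <= rho j.
Proof. by rewrite exprn_ge0 // invr_ge0. Qed.

Lemma invq_le : q%:R^-1 <= 1 / 2 :> R.
Proof. by rewrite div1r lef_pV2 ?posrE ?q_ge2 // (lt_le_trans _ q_ge2). Qed.

Lemma rho_le j : (j < m)%N -> rho j <= 1 / 2.
Proof.
move=> /delta_gt0; rewrite /rho; case: (delta j) => // d _.
rewrite exprS; apply: le_trans invq_le; rewrite ler_piMr ?invr_ge0 //.
by rewrite exprn_ile1 ?invr_ge0 // (le_trans invq_le) //; lra.
Qed.

(** Primes are grouped by degree, with at most [q^d / d] in each group. *)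
Lemma sum_degrees_le (h : nat -> R) (P : pred nat) K :
  (forall d, 0 <= h d) ->
  \sum_(j < m | P (delta j) && (delta j <= K)%N) h (delta j) <=
  \sum_(1 <= d < K.+1 | P d) q%:R ^+ d / d%:R * h d.
Proof.
move=> h0.
rewrite (partition_big (fun j : 'I_m => inord (delta j) : 'I_K.+1) xpredT) //=.
rewrite big_mkcond /= [leRHS]big_mkcond /= [leRHS]big_add1 /= big_mkord.
rewrite big_ord_recl /= big_pred0 ?add0r; last first.
  move=> j; apply/negbTE/negP => /andP[/andP[_ jK]] /eqP /(congr1 val) /=.
  by rewrite inordK // => j0; have := delta_gt0 (ltn_ord j); rewrite j0.
apply: ler_sum => d _.
rewrite (eq_bigl (fun j : 'I_m => P d.+1 && (delta j == d.+1))); last first.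
  move=> j; apply/idP/idP => [/andP[/andP[Pj jK] /eqP /(congr1 val) /=]|/andP[Pd /eqP jd]].
    by rewrite inordK // /bump add1n => <-; rewrite Pj eqxx.
  rewrite jd Pd ltn_ord /=; apply/eqP/val_inj; rewrite /= inordK ?add1n //.
  exact: ltn_ord.
case: ifP => Pd; last by rewrite big_pred0.
rewrite (eq_bigr (fun=> h d.+1)) => [|j /andP[_ /eqP ->] //].
rewrite sumr_const -[_ *+ _]mulr_natl ler_wpM2r // ler_pdivlMr ?ltr0n //.
by rewrite -natrM -natrX ler_nat delta_count.
Qed.

Lemma sum_prefix_degrees_le (h : nat -> R) J K :
  (forall d, 0 <= h d) -> (J <= m)%N -> (forall j, (j < J)%N -> (delta j <= K)%N) ->
  \sum_(j < J) h (delta j) <= \sum_(1 <= d < K.+1) q%:R ^+ d / d%:R * h d.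
Proof.
move=> h0 Jm JK; apply: le_trans (sum_degrees_le predT K h0).
rewrite (big_ord_widen m (fun j => h (delta j)) Jm) big_mkcond /= [leRHS]big_mkcond /=.
apply: ler_sum => j _; case: ifP => [jJ|_]; first by rewrite JK.
by case: ifP.
Qed.

Lemma q_expK d : q%:R ^+ d * q%:R^-1 ^+ d = 1 :> R.
Proof. by rewrite -exprMn mulfV ?expr1n // gt_eqF // (lt_le_trans _ q_ge2). Qed.

Lemma q_cancel d x : q%:R ^+ d * q%:R^-1 ^+ d * x = x :> R.
Proof. by rewrite q_expK mul1r. Qed.

(** Mertens-type bound: the primes of degree [d] contribute at most [1/d]. *)
Lemma sum_rho_le i K : (0 < K)%N -> (i <= m)%N ->
  (forall j, (j < i)%N -> (delta j <= K)%N) -> \sum_(j < i) rho j <= 1 + ln K%:R.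
Proof.
move=> K0 im iK; apply: le_trans (harmonic_le R K0).
apply: le_trans (sum_prefix_degrees_le (h := fun d => q%:R^-1 ^+ d) _ im iK) _.
  by move=> d; rewrite exprn_ge0 ?invr_ge0.
by apply: ler_sum => d _; rewrite mulrAC q_expK mul1r.
Qed.

(** With [y = u/q], the logarithm is at most the sum of [2 y^d + 6 y^(2d)] over the primes. The
    first part gives [2 (1 + ln k + e)], the second at most [6 * 8/3 = 16]. *)
Lemma small_primes_product gamma J k : (10 <= k)%N -> (J <= m)%N ->
  (forall j, (j < J)%N -> (delta j <= k)%N) ->
  \prod_(j < J) \sum_(a < gamma.+1)
     local_factor rho j a * (expR (k%:R^-1) ^+ delta j) ^+ a <=
  expR (18 + 2 * expR 1) * k%:R ^+ 2.
Proof.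
move=> k10 Jm Jk; set u : R := expR k%:R^-1.
have k0 : 0 < k%:R :> R by rewrite ltr0n (leq_trans _ k10).
have k10R : 10 <= k%:R :> R by rewrite ler_nat.
have kV : k%:R^-1 <= 1 / 10 :> R by rewrite div1r lef_pV2 ?posrE.
have u1 : 1 <= u by rewrite -expR0 ler_expR invr_ge0 ltW.
have u0 : 0 <= u by rewrite expR_ge0.
(* From [k >= 10]: [e^(-2/k) >= 1 - 2/k >= 4/5]. *)
have u2 : u ^+ 2 <= 5 / 4.
  have := expR_ge1Dx (- (2 * k%:R^-1) : R); rewrite expRN expRM_natl -/u => h.
  have p0 : 0 < u ^+ 2 by rewrite exprn_gt0 ?expR_gt0.
  have : (4 / 5) * u ^+ 2 <= 1 by rewrite -ler_pdivlMr // mul1r; apply: le_trans h; lra.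
  by lra.
have u54 : u <= 5 / 4 by apply: le_trans u2; rewrite expr2 ler_peMr.
pose y := u / q%:R.
have y0 : 0 <= y by rewrite mulr_ge0 ?invr_ge0.
have y58 : y <= 5 / 8.
  by apply: le_trans (ler_pM u0 _ u54 invq_le) _; rewrite ?invr_ge0 //; lra.
have yE j : rho j * u ^+ delta j = y ^+ delta j by rewrite /rho /y exprMn mulrC.
have yJ j : (j < J)%N -> y ^+ delta j <= 5 / 8.
  move=> jJ; have := delta_gt0 (leq_trans jJ Jm); case: (delta j) => // d _.
  rewrite exprS; apply: (le_trans _ y58); rewrite ler_piMr // exprn_ile1 //; lra.
apply: (@le_trans _ _ (\prod_(j < J) expR (2 * y ^+ delta j + 6 * (y ^+ delta j) ^+ 2))).
  apply: ler_prod => j _; apply/andP; split.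
    apply: sumr_ge0 => a _; rewrite mulr_ge0 ?exprn_ge0 //.
    exact: (local_factor_ge0 rho_ge0).
  rewrite -yE; apply: local_factor_weighted_le; rewrite ?rho_ge0 ?exprn_ge0 //.
  by rewrite yE yJ.
rewrite -expR_sum -[k%:R ^+ 2]lnK ?posrE ?exprn_gt0 // -expRD ler_expR.
apply: le_trans (sum_prefix_degrees_le (h := fun d => 2 * y ^+ d + 6 * (y ^+ d) ^+ 2) _ Jm Jk) _.
  by move=> d; rewrite addr_ge0 // mulr_ge0 ?exprn_ge0.
apply: (@le_trans _ _ (\sum_(1 <= d < k.+1)
    (2 * (d%:R^-1 + expR 1 * k%:R^-1) + 6 * (5 / 8) ^+ d))).
  rewrite big_nat [leRHS]big_nat; apply: ler_sum => d /andP[d0 dk].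
  have d1 : 1 <= d%:R :> R by rewrite ler1n.
  have dp : 0 < d%:R :> R by rewrite ltr0n.
  have dV1 : d%:R^-1 <= 1 :> R by rewrite invf_le1.
  (* For [z = d/k <= 1] one has [e^z - 1 <= z e^z <= e z], so the Rankin weight costs only a bounded
     amount in total. *)
  have ud : u ^+ d <= 1 + d%:R * k%:R^-1 * expR 1.
    rewrite /u -expRM_natl; have := expR_sub1_le (d%:R * k%:R^-1 : R).
    set z := d%:R * k%:R^-1; move=> hz.
    have z0 : 0 <= z by rewrite mulr_ge0 ?invr_ge0.
    have z1 : z <= 1 by rewrite ler_pdivrMr // mul1r ler_nat.
    have : z * expR z <= z * expR 1 by rewrite ler_wpM2l // ler_expR.
    by lra.
  rewrite mulrDr lerD //.
    have -> : q%:R ^+ d / d%:R * (2 * y ^+ d) = 2 * (u ^+ d / d%:R).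
      by rewrite /y exprMn -[RHS](q_cancel d); ring.
    rewrite ler_wpM2l // ler_pdivrMr // mulrDl mulVf ?gt_eqF //.
    by apply: le_trans ud _; rewrite lerD2l [leRHS]mulrAC [leLHS]mulrC mulrA.
  have -> : q%:R ^+ d / d%:R * (6 * (y ^+ d) ^+ 2) = 6 * ((u ^+ 2 / q%:R) ^+ d / d%:R).
    by rewrite /y !exprMn -[RHS](q_cancel d); ring.
  rewrite ler_wpM2l // -[leRHS]mulr1 ler_pM ?exprn_ge0 ?mulr_ge0 ?invr_ge0 ?exprn_ge0 //.
  rewrite lerXn2r ?nnegrE ?mulr_ge0 ?invr_ge0 ?exprn_ge0 //.
  by apply: le_trans (ler_pM _ _ u2 invq_le) _; rewrite ?invr_ge0 ?exprn_ge0 //; lra.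
rewrite big_split /= -!mulr_sumr big_split /=.
have -> : \sum_(1 <= d < k.+1) expR 1 * k%:R^-1 = expR 1 :> R.
  by rewrite sumr_const_nat subn1 /= -[(_ / _) *+ _]mulr_natr mulfVK // gt_eqF.
have H := harmonic_le R (leq_trans (isT : 0 < 10)%N k10).
have G : \sum_(1 <= d < k.+1) (5 / 8) ^+ d <= 8 / 3 :> R.
  apply: (@le_trans _ _ (\sum_(0 <= d < k.+1) (5 / 8) ^+ d)).
    by rewrite [leRHS]big_ltn // expr0 lerDr.
  have g0 : 0 <= 5 / 8 :> R by lra.
  have g1 : 5 / 8 < 1 :> R by lra.
  rewrite big_mkord; apply: le_trans (geometric_sum_le _ g0 g1) _.
  by rewrite -[leLHS]mul1r ler_pdivrMr; lra.
rewrite lnXn // -mulr_natl; lra.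
Qed.

(** By the Mertens bound the product is at most [e^36 d^36] with [d = delta i], which [C (5/4)^d]
    absorbs. The squared factor gives [q^(-2d)] against at most [q^d / d] primes, leaving a
    geometric tail of ratio [5/(4q)]. *)
Lemma large_primes_sum (s gamma k : nat) (C : R) : 0 <= C ->
  (forall d : nat, d%:R ^+ 36 <= C * (5 / 4) ^+ d) ->
  \sum_(i < m | (k < delta i)%N)
    2 * (s%:R ^+ 2 * ((\sum_(a < gamma.+1 | a != 0%N :> nat) rho i ^+ a) ^+ 2 *
    \prod_(j < i) \sum_(a < gamma.+1) \sum_(c < gamma.+1)
       local_factor rho j (maxn a c))) <=
  (22 * expR 36 * C) * (s%:R ^+ 2 * (5 / 4 / q%:R) ^+ k).
Proof.
move=> C0 HC; set r : R := 5 / 4 / q%:R.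
have r0 : 0 <= r by rewrite mulr_ge0 ?invr_ge0 //; lra.
have r58 : r <= 5 / 8 by have := invq_le; rewrite /r; lra.
pose A : R := 8 * s%:R ^+ 2 * expR 36 * C.
have A0 : 0 <= A by rewrite !mulr_ge0 ?exprn_ge0 ?expR_ge0.
pose h d : R := A * (r ^+ d * q%:R^-1 ^+ d).
have h0 d : 0 <= h d by rewrite mulr_ge0 // mulr_ge0 ?exprn_ge0 ?invr_ge0.
apply: (@le_trans _ _ (\sum_(i < m | (k < delta i)%N) h (delta i))).
  apply: ler_sum => i ki; have di := delta_gt0 (ltn_ord i).
  have di0 : 0 < (delta i)%:R :> R by rewrite ltr0n.
  have prodE : \prod_(j < i) \sum_(a < gamma.+1) \sum_(c < gamma.+1)
      local_factor rho j (maxn a c) <= expR 36 * (delta i)%:R ^+ 36.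
    apply: (@le_trans _ _ (\prod_(j < i) expR (36 * rho j))).
      apply: ler_prod => j _; have jm : (j < m)%N by apply: ltn_trans (ltn_ord i).
      rewrite local_factor_pair_le ?rho_ge0 ?rho_le // andbT.
      by do 2!apply: sumr_ge0 => ? _; apply: (local_factor_ge0 rho_ge0).
    rewrite -expR_sum -mulr_sumr -[_ ^+ 36]lnK ?posrE ?exprn_gt0 // -expRD ler_expR.
    rewrite lnXn // -[ln _ *+ _]mulr_natl -{2}[36]mulr1 -mulrDr ler_wpM2l //.
    apply: sum_rho_le di _ _; first exact: ltnW.
    by move=> j ji; apply: delta_mono; rewrite (ltnW ji) ltn_ord.
  have powE : (\sum_(a < gamma.+1 | a != 0%N :> nat) rho i ^+ a) ^+ 2 <= 4 * rho i ^+ 2.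
    apply: (@le_trans _ _ ((2 * rho i) ^+ 2)); last by rewrite exprMn; lra.
    rewrite lerXn2r ?nnegrE ?mulr_ge0 ?rho_ge0 //.
      by apply: sumr_ge0 => a _; rewrite exprn_ge0 ?rho_ge0.
    by rewrite nontrivial_powers_le ?rho_ge0 ?rho_le.
  have -> : h (delta i) =
      2 * (s%:R ^+ 2 * ((4 * rho i ^+ 2) * (expR 36 * (C * (5 / 4) ^+ delta i)))).
    by rewrite /h /A /r exprMn /rho; ring.
  rewrite !ler_wpM2l ?exprn_ge0 //; apply: ler_pM powE _ => //.
  - by rewrite exprn_ge0 // sumr_ge0 // => a _; rewrite exprn_ge0 ?rho_ge0.
  - by apply: prodr_ge0 => j _; do 2!apply: sumr_ge0 => ? _; apply: (local_factor_ge0 rho_ge0).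
  - by apply: le_trans prodE _; rewrite ler_wpM2l ?expR_ge0.
pose K := (k + \max_(i < m) delta i)%N.
have iK (i : 'I_m) : (delta i <= K)%N.
  exact: leq_trans (leq_bigmax (F := fun i : 'I_m => delta i) i) (leq_addl _ _).
rewrite (eq_bigl (fun i : 'I_m => (k < delta i)%N && (delta i <= K)%N)); last first.
  by move=> i; rewrite iK andbT.
apply: le_trans (sum_degrees_le (fun d => (k < d)%N) K h0) _.
have kK : (k <= K)%N by apply: leq_addr.
apply: (@le_trans _ _ (\sum_(1 <= d < K.+1 | (k < d)%N) A * r ^+ d)).
  rewrite big_nat_cond [leRHS]big_nat_cond; apply: ler_sum => d /andP[/andP[d0 _] _].
  have -> : q%:R ^+ d / d%:R * h d = A * r ^+ d * d%:R^-1.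
    by rewrite /h -[RHS](q_cancel d); ring.
  by rewrite ler_piMr ?(mulr_ge0 A0) ?exprn_ge0 // invf_le1 ?ler1n ?ltr0n.
apply: (@le_trans _ _ (\sum_(k <= d < K.+1) A * r ^+ d)).
  rewrite (big_nat_widenl 1 0) // (big_nat_widenl k 0) //.
  rewrite big_mkcond [leRHS]big_mkcond; apply: ler_sum => d _ /=.
  case: (ltnP k d) => kd /=; first by rewrite (ltnW kd); case: ifP => // _; rewrite mulr_ge0 ?exprn_ge0.
  by case: ifP => // _; rewrite mulr_ge0 ?exprn_ge0.
rewrite -mulr_sumr -{1}[k]add0n big_addn big_mkord.
rewrite (eq_bigr (fun d : 'I__ => r ^+ k * r ^+ d)) => [|d _]; last by rewrite exprD mulrC.
rewrite -mulr_sumr.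
have r1 : r < 1 by lra.
have := geometric_sum_le (K.+1 - k) r0 r1; set S := \sum_(_ < _) _ => SE.
have S83 : S <= 8 / 3.
  by apply: le_trans SE _; rewrite -[leLHS]mul1r ler_pdivrMr; lra.
have rk0 : 0 <= r ^+ k by rewrite exprn_ge0.
have : A * (r ^+ k * S) <= A * (r ^+ k * (8 / 3)) by rewrite !ler_wpM2l.
move/le_trans; apply.
have W0 : 0 <= s%:R ^+ 2 * expR 36 * C * r ^+ k :> R by rewrite !mulr_ge0 ?exprn_ge0 ?expR_ge0.
(* The constant is [8 * 8/3 = 64/3], rounded up to 22. *)
have -> : A * (r ^+ k * (8 / 3)) = 64 / 3 * (s%:R ^+ 2 * expR 36 * C * r ^+ k).
  by rewrite /A; field.
have -> : 22 * expR 36 * C * (s%:R ^+ 2 * r ^+ k) = 22 * (s%:R ^+ 2 * expR 36 * C * r ^+ k).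
  by ring.
by rewrite ler_wpM2r //; lra.
Qed.

End DegreeSums.

(** * Covering systems *)

Lemma in_box_nth (X : finType) (T : finType) (b : T -> nat -> X -> bool) t x0 x :
  (forall k, (k < size x)%N -> b t (size x - k.+1)%N (nth x0 x k)) -> in_box b t x.
Proof.
elim: x => [//|y x IHx] bx /=; apply/andP; split.
  by have := bx 0%N isT; rewrite /= subn1.
by apply: IHx => k kx; have := bx k.+1 kx; rewrite /= subSS.
Qed.

Lemma in_box_drop (X : finType) (T : finType) (b : T -> nat -> X -> bool) t k x :
  in_box b t x -> in_box b t (drop k x).
Proof. by elim: x k => [|y x IHx] [|k] //= /andP[_ /IHx]. Qed.

Lemma min_deg_le (F : fieldType) n (d : 'I_n -> {poly F}) i : (min_deg d <= pdeg (d i))%N.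
Proof.
rewrite /min_deg; move: (\max_(_ < _) _)%N => M;
have : i \in index_enum 'I_n by apply: mem_index_enum.
elim: (index_enum _) => // j r IHr; rewrite inE big_cons geq_min => /predU1P[<-|/IHr ->].
  by rewrite leqnn.
by rewrite orbT.
Qed.

Lemma size_prod_exp (F : fieldType) m (p : nat -> {poly F}) (e : nat -> nat) :
  (forall j, (j < m)%N -> p j \is monic) ->
  size (\prod_(j < m) p j ^+ e j) = (\sum_(j < m) e j * (size (p j)).-1).+1.
Proof.
move=> pm; rewrite size_prod => [|j _]; last by rewrite expf_neq0 // monic_neq0 ?pm.
rewrite (eq_bigr (fun j : 'I_m => (e j * (size (p j)).-1).+1)) => [|j _]; last first.
  by rewrite mulnC -size_exp prednK // size_poly_gt0 expf_neq0 // monic_neq0 ?pm.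
under eq_bigr do rewrite -addn1.
by rewrite big_split /= sum1_card -addSn addnK.
Qed.

Section CoveringMass.
Variables (R : realType) (F : finFieldType) (s n : nat) (a d : 'I_n -> {poly F}).
Hypothesis d_monic : forall i, d i \is monic.
Hypothesis d_deg : forall i, (1 <= pdeg (d i))%N.
Hypothesis d_mult : forall D, (#|[pred i | d i == D]| <= s)%N.
Hypothesis cover : covering_system a d.

Let D := (\max_(i < n) pdeg (d i))%N.
Let P := primes_upto F D.
Let m := size P.
Let delta j := (size P`_j).-1.
Let q : R := #|F|%:R.
(** All coordinates share this type, the polynomials of degree below [D]: its uniform measure gives
    a class modulo a prime power of degree [l <= D] mass at most [q^(-l)]. *)
Let X : finType := {poly_D F}.

Lemma primes_mi j : (j < m)%N -> monic_irreducible P`_j.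
Proof. by move=> jm; have := mem_nth 0 jm; rewrite mem_primes_upto => /andP[]. Qed.

Lemma primes_monic j : (j < m)%N -> P`_j \is monic.
Proof. by move=> /primes_mi /andP[]. Qed.

Lemma primes_delta_gt0 j : (j < m)%N -> (0 < delta j)%N.
Proof. by move=> /primes_mi /monic_irreducible_gt1; rewrite /delta; case: (size _) => [|[]]. Qed.

Lemma primes_delta_mono i j : (i <= j < m)%N -> (delta i <= delta j)%N.
Proof. by move=> ij; rewrite /delta -!subn1 leq_sub2r // primes_upto_sorted. Qed.

Lemma primes_delta_count k : (0 < k)%N ->
  (#|[pred j : 'I_m | delta j == k]| * k <= #|F| ^ k)%N.
Proof.
move=> k0.
pose l := [seq P`_(val j) | j in [pred j : 'I_m | delta j == k]].
have -> : #|[pred j : 'I_m | delta j == k]| = size l by rewrite size_image.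
apply: count_monic_irreducible => //.
- rewrite map_inj_in_uniq ?enum_uniq // => i j _ _ /eqP.
  by rewrite (nth_uniq 0 (ltn_ord i) (ltn_ord j) (primes_upto_uniq F D)) => /eqP /val_inj.
- by apply/allP => p; rewrite /l => /fintype.imageP[j _ ->]; exact: primes_mi (ltn_ord j).
- apply/allP => p; rewrite /l => /fintype.imageP[j]; rewrite inE => /eqP <- ->.
  by rewrite prednK // size_poly_gt0 monic_neq0 // (primes_monic (ltn_ord j)).
Qed.

Lemma pdeg_leD i : (pdeg (d i) <= D)%N.
Proof. exact: (leq_bigmax (F := fun i => pdeg (d i))). Qed.

Lemma exists_exponents : exists e : 'I_n -> nat -> nat,
  forall i, d i = \prod_(j < m) P`_j ^+ e i j.
Proof.
apply: (@fin_all_exists 'I_n (fun=> nat -> nat)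
  (fun i e => d i = \prod_(j < m) P`_j ^+ e j)) => i; apply: monic_factorization => //.
by have := pdeg_leD i; rewrite /pdeg; case: (size _).
Qed.

Lemma card_residues_gt0 : (0 < #|X|)%N.
Proof. by rewrite card_npoly expn_gt0 (ltnW (finNzRing_gt1 F)). Qed.

(* The total mass of the distorted measures on the sets covered at each step is
   at least 1, since otherwise some point is not covered at all. *)
Lemma covering_mass (k : nat) (C : R) : (10 <= k)%N -> 0 <= C ->
  (forall l : nat, l%:R ^+ 36 <= C * (5 / 4) ^+ l) ->
  1 <= (expR k%:R^-1 ^+ min_deg d)^-1 * (s%:R * (expR (18 + 2 * expR 1) * k%:R ^+ 2))
       + 22 * expR 36 * C * (s%:R ^+ 2 * (5 / 4 / q) ^+ k).
Proof.
move=> k10 C0 HC; have [e eE] := exists_exponents.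
have degE i : pdeg (d i) = (\sum_(j < m) e i j * delta j)%N.
  by rewrite /pdeg eE (size_prod_exp _ primes_monic).
have ed_le i j : (j < m)%N -> (e i j * delta j <= D)%N.
  by move=> jm; apply: leq_trans (pdeg_leD i); rewrite degE (bigD1 (Ordinal jm)) //= leq_addr.
have e_le i j : (j < m)%N -> (e i j <= D)%N.
  by move=> jm; apply: leq_trans (ed_le i j jm); rewrite leq_pmulr // primes_delta_gt0.
(* The largest index with a nonzero exponent; one exists because moduli have positive degree. *)
have [top topP] : exists top : 'I_n -> nat, forall i,
    [/\ (top i < m)%N, (0 < e i (top i))%N & forall j, (top i < j < m)%N -> e i j = 0%N].
  apply: (@fin_all_exists 'I_n (fun=> nat) (fun i t =>
    [/\ (t < m)%N, (0 < e i t)%N & forall j, (t < j < m)%N -> e i j = 0%N])) => i.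
  have ex : exists j, (j < m)%N && (0 < e i j)%N.
    have := d_deg i; rewrite degE lt0n sum_nat_eq0 negb_forall => /existsP[j].
    by rewrite muln_eq0 negb_or -!lt0n => /andP[ej _]; exists j; rewrite ltn_ord.
  have ub j : (j < m)%N && (0 < e i j)%N -> (j <= m)%N by case/andP=> /ltnW.
  case: (ex_maxnP ex ub) => t /andP[tm et] tmax; exists t; split => // j /andP[tj jm].
  by apply/eqP; rewrite -leqn0 leqNgt; apply: contraTN tj => ej; rewrite -leqNgt tmax // jm.
pose b i j (y : X) := P`_j ^+ e i j %| val y - a i.
pose rho j : R := q^-1 ^+ delta j.
have q1 : (1 < #|F|)%N by apply: finNzRing_gt1.
have q0 : 0 < q by rewrite ltr0n ltnW.
have rho0 j : 0 <= rho j by rewrite exprn_ge0 ?invr_ge0 ?ltW.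
have b_full i j y : e i j = 0%N -> b i j y by rewrite /b => ->; rewrite expr0 dvd1p.
have b_avg i j : (j < m)%N -> avg (fun y => (b i j y)%:R) <= rho j ^+ e i j.
  move=> jm; have pn0 : P`_j ^+ e i j != 0 by rewrite expf_neq0 // monic_neq0 // primes_monic.
  have se : (size (P`_j ^+ e i j)).-1 = (e i j * delta j)%N by rewrite size_exp mulnC.
  have sD : (size (P`_j ^+ e i j) <= D.+1)%N.
    by have := ed_le i j jm; rewrite -se; case: (size _).
  have := card_residue_class (a i) pn0 sD; rewrite se => cle.
  rewrite /avg card_npoly ler_pdivrMr ?ltr0n ?expn_gt0 ?(ltnW q1) //.
  have -> : \sum_y (b i j y)%:R = #|[pred y | b i j y]|%:R :> R.
    rewrite -sum1_card natr_sum big_mkcond [RHS]big_mkcond /=.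
    by apply: eq_bigr => y _; rewrite inE; case: (b i j y).
  rewrite -(subnK (ed_le i j jm)) expnD natrM !natrX /rho -exprM mulnC.
  rewrite mulrCA -exprMn mulVf ?gt_eqF // expr1n mulr1 -natrX ler_nat.
  exact: cle.
have mult i : (#|[pred u | [forall j : 'I_m, e u j == e i j]]| <= s)%N.
  apply: leq_trans (d_mult (d i)); apply/subset_leq_card/fintype.subsetP => u.
  rewrite !inE => /forallP eu.
  by rewrite !eE; apply/eqP/eq_bigr => j _; rewrite (eqP (eu j)).
have top_lt i : (top i < m)%N by case: (topP i).
have e_top i : (0 < e i (top i))%N by case: (topP i).
have e_after i j : (top i < j < m)%N -> e i j = 0%N by case: (topP i) => _ _; apply.
set u := expR _.
have u1 : 1 <= u by rewrite -expR0 ler_expR invr_ge0.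
have u0 : 0 <= u by rewrite expR_ge0.
(* First prime of degree above [k], or [m] if there is none; it separates the two moment bounds. *)
pose J := find (fun p => (k < (size (p : {poly F})).-1)%N) P.
have Jm : (J <= m)%N by apply: find_size.
have smallJ j : (j < J)%N -> (delta j <= k)%N.
  by move=> jJ; rewrite leqNgt; apply/negP => h; have := before_find 0 jJ; rewrite h.
have largeJ i : (J <= i < m)%N -> (k < delta i)%N.
  move=> /andP[Ji im]; apply: leq_trans (primes_delta_mono (_ : J <= i < m)%N); last by rewrite Ji.
  by apply: (nth_find 0 (a := fun p => (k < (size (p : {poly F})).-1)%N)); rewrite has_find (leq_ltn_trans Ji).
have X0 := card_residues_gt0.
rewrite leNgt; apply/negP => lt1.
have [|x sx nbad] := @exists_not_bad R X X0 (covered b top) m.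
  apply: le_lt_trans lt1.
  rewrite (bigID (fun i : 'I_m => (i < J)%N)) /=; apply: lerD.
    rewrite -(big_ord_widen m (fun i => dexp (covered b top) i (hit R (covered b top))) Jm).
    have Vle i : u ^+ min_deg d <= \prod_(j < m) (u ^+ delta j) ^+ e i j.
      rewrite (eq_bigr (fun j : 'I_m => u ^+ (e i j * delta j))) => [|j _]; last first.
        by rewrite mulnC exprM.
      by rewrite -expr_sum -degE ler_weXn2l // min_deg_le.
    have V0 : 0 < u ^+ min_deg d by rewrite exprn_gt0 ?expR_gt0.
    have v0 j : 0 <= u ^+ delta j by rewrite exprn_ge0.
    apply: le_trans (small_hits X0 rho0 b_full b_avg e_top e_after e_le mult Jm V0 v0 Vle) _.
    rewrite ler_wpM2l ?invr_ge0 ?(ltW V0) // ler_wpM2l //.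
    exact: (small_primes_product R q1 primes_delta_gt0 primes_delta_count D k10 Jm smallJ).
  apply: le_trans (large_primes_sum q1 primes_delta_gt0 primes_delta_mono primes_delta_count s D k C0 HC).
  rewrite big_mkcond [leRHS]big_mkcond /=; apply: ler_sum => i _.
  rewrite -leqNgt; case: ifP => [Ji|_].
    have -> : (k < delta i)%N by apply: largeJ; rewrite Ji ltn_ord.
    exact: (large_hit X0 rho0 b_full b_avg e_top e_after e_le mult).
  case: ifP => // _; apply: mulr_ge0 => //; apply: mulr_ge0; first by rewrite exprn_ge0.
  apply: mulr_ge0; first by rewrite exprn_ge0 // sumr_ge0 // => l _; apply: exprn_ge0 (rho0 i).
  by apply: prodr_ge0 => j _; do 2!apply: sumr_ge0 => ? _; apply: (local_factor_ge0 rho0).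
pose y0 : X := 0.
(* Points list their coordinates in reverse, so coordinate [j] sits at position [m - j - 1]. *)
pose y j := val (nth y0 x (m - j.+1)).
have [|x0 x0P] := @chinese_remainder F (nth 0 P) y m D.
  move=> i j /andP[ij jm]; have im := ltn_trans ij jm.
  apply: monic_irreducible_coprime; rewrite ?primes_mi //.
  by rewrite nth_uniq ?primes_upto_uniq // ltn_eqF.
have : [set: {poly F}]%classic x0 by [].
(* The polynomial [x0] realizing the uncovered point lies in some progression [t], so the whole
   point lies in the box of [t]. *)
rewrite cover => -[t _ [g _ x0E]].
have in_t : in_box b t x.
  apply: (in_box_nth (x0 := y0)) => k0; rewrite sx => k0m; set j := (m - k0.+1)%N.
  have jm : (j < m)%N by rewrite /j ltn_subrL (leq_ltn_trans _ k0m).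
  have -> : nth y0 x k0 = nth y0 x (m - j.+1) by congr nth; rewrite /j; lia.
  rewrite /b -(subrKA x0) dvdp_add //.
    rewrite -dvdpNr opprB; apply: dvdp_trans (x0P _ jm).
    by rewrite dvdp_exp2l // e_le.
  rewrite -x0E addrAC subrr add0r dvdp_mulr // eE (bigD1 (Ordinal jm)) //=.
  exact: dvdp_mulIl.
(* Dropping the coordinates after [top t] leaves the prefix at which [t] counts as covering: a
   contradiction. *)
have := nbad (m - (top t).+1)%N; rewrite sx ltn_subrL (leq_ltn_trans _ (top_lt t)) //= => /(_ isT).
have := in_box_drop (m - (top t).+1) in_t.
have : size (drop (m - (top t).+1) x) = (top t).+1 by rewrite size_drop sx subKn.
case: (drop _ x) => // z x' [sx'] in_t'; case/negP.
by apply/existsP; exists t; rewrite sx' eqxx.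
Qed.

End CoveringMass.

(** * Choice of the cut-off degree and the final bound *)

Lemma up_log_le_logb (R : realType) (q s : nat) : (1 < q)%N -> (0 < s)%N ->
  (up_log q (s ^ 3))%:R <= 1 + 3 * logb q%:R s%:R :> R.
Proof.
move=> q1 s0; have lq : 0 < ln q%:R :> R by rewrite ln_gt0 // ltr1n.
have [s1|s1] := leqP s 1.
  have -> : s = 1%N by apply/eqP; rewrite eqn_leq s1.
  by rewrite exp1n up_log1 /logb ln1 mul0r mulr0 addr0 ler01.
have s31 : (1 < s ^ 3)%N by rewrite -{1}(exp1n 3) ltn_exp2r.
have /andP[lt _] := up_log_bounds q1 s31.
have u0 : (0 < up_log q (s ^ 3))%N by rewrite up_log_gt0 // ?q1.
rewrite -{1}(prednK u0) -natr1 addrC lerD2l /logb mulrA ler_pdivlMr //.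
have sR : 0 < s%:R :> R by rewrite ltr0n.
have qR : 0 < q%:R :> R by rewrite ltr0n ltnW.
rewrite !mulr_natl -!lnXn // ler_ln ?posrE ?exprn_gt0 //.
by rewrite -!natrX ler_nat ltnW.
Qed.

(** After cubing, [(5/4)^3 < 2 <= q] bounds the cube by [Q^2 Q / Q^3] with [Q = q^k]. This is why
    [k] about [3 log_q s] suffices. *)
Lemma tail_power_le (R : realType) (q s c k : nat) : (1 < q)%N ->
  (2 ^ (3 * c) * s ^ 3 <= q ^ k)%N ->
  4 ^+ c * (s%:R ^+ 2 * (5 / 4 / q%:R) ^+ k) <= 1 :> R.
Proof.
move=> q1 qk; have q0 : 0 < q%:R :> R by rewrite ltr0n ltnW.
have r0 : 0 <= 5 / 4 / q%:R :> R by rewrite mulr_ge0 ?invr_ge0 // ?ltW //; lra.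
rewrite -(@ler_pXn2r _ 3) ?nnegrE ?mulr_ge0 ?exprn_ge0 //.
set Q : R := q%:R ^+ k; have Q0 : 0 < Q by rewrite exprn_gt0.
have W : 2 ^+ (3 * c) * s%:R ^+ 3 <= Q by rewrite /Q -!natrX -natrM ler_nat.
have W0 : 0 <= 2 ^+ (3 * c) * s%:R ^+ 3 :> R by rewrite mulr_ge0 ?exprn_ge0.
have T : (5 / 4) ^+ 3 ^+ k <= Q.
  apply: (@le_trans _ _ (2 ^+ k)); first by rewrite lerXn2r ?nnegrE ?exprn_ge0 //; lra.
  by rewrite lerXn2r ?nnegrE ?(ltW q0) // ler_nat.
have T0 : 0 <= (5 / 4) ^+ 3 ^+ k :> R by rewrite !exprn_ge0 //; lra.
have -> : (4 ^+ c * (s%:R ^+ 2 * (5 / 4 / q%:R) ^+ k)) ^+ 3 =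
    (2 ^+ (3 * c) * s%:R ^+ 3) ^+ 2 * (5 / 4) ^+ 3 ^+ k / Q ^+ 3.
  have e4 : 4 ^+ c ^+ 3 = 2 ^+ (3 * c) ^+ 2 :> R.
    have -> : 4 = 2 ^+ 2 :> R by rewrite expr2; lra.
    by rewrite -!exprM; congr (_ ^+ _); lia.
  have er : (5 / 4 / q%:R) ^+ k = (5 / 4) ^+ k / Q :> R by rewrite exprMn exprVn.
  rewrite er exprMn e4 [(5 / 4) ^+ 3 ^+ k]exprAC.
  by move: (2 ^+ _) ((5 / 4) ^+ k) => x y; field; rewrite gt_eqF.
rewrite expr1n ler_pdivrMr ?exprn_gt0 // mul1r.
have -> : Q ^+ 3 = Q ^+ 2 * Q by ring.
apply: ler_pM => //; first by rewrite exprn_ge0.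
by rewrite lerXn2r // nnegrE ltW.
Qed.

Theorem theorem1p4 (R : realType) :
  exists c : R, 0 < c /\
    forall (F : finFieldType) (s n : nat) (a d : 'I_n -> {poly F}),
      (0 < s)%N ->
      (forall i : 'I_n, d i \is monic) ->
      (forall i : 'I_n, (1 <= pdeg (d i))%N) ->
      covering_system a d ->
      has_multiplicity d s ->
      (min_deg d)%:R <=
        3 * (c + 3 * logb #|F|%:R s%:R) *
        ln (c * s%:R + 3 * s%:R * logb #|F|%:R s%:R).
Proof.
have [C C0 HC] := power_le_exponential R 36.
pose B : R := 22 * expR 36 * C.
have B0 : 0 <= B by rewrite mulr_ge0 ?mulr_ge0 ?expR_ge0 // ltW.
(* Since [n < 4^n], this gives [4 B <= 4^c1], which brings the second-moment total down to 1/4. *)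
pose c1 := Num.bound (4 * B).
have c1P : 4 * B <= 4 ^+ c1.
  have /ltW : 4 * B < c1%:R by apply: archi_boundP; rewrite mulr_ge0.
  move/le_trans; apply; rewrite -natrX ler_nat ltnW // ltn_expl //.
pose E : R := expR (18 + 2 * expR 1).
have E0 : 0 < E by apply: expR_gt0.
(* The first summand secures [k <= kappa], 11 being the 10 in [k] plus 1 for rounding up the
   logarithm; the second absorbs the first-moment constant. *)
pose c : R := (3 * c1 + 11)%:R + 4 * E.
have c11 : (3 * c1 + 11)%:R <= c by rewrite /c lerDl mulr_ge0 // ltW.
have cE : 4 * E <= c by rewrite /c lerDr.
exists c; split; first by rewrite (lt_le_trans _ c11) // ltr0n addnS.
move=> F s n a d s0 dm ddeg cover [_ dmult].
set q := #|F|; have q1 : (1 < q)%N by apply: finNzRing_gt1.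
set lg : R := logb _ _.
have lg0 : 0 <= lg by rewrite divr_ge0 // ln_ge0 // ler1n // ltnW.
set kappa := c + 3 * lg.
have -> : c * s%:R + 3 * s%:R * lg = s%:R * kappa by rewrite /kappa; ring.
pose k := (3 * c1 + 10 + up_log q (s ^ 3))%N.
have k10 : (10 <= k)%N by rewrite /k; lia.
have kk : k%:R <= kappa.
  rewrite /k natrD /kappa; have := up_log_le_logb R q1 s0; rewrite -/lg.
  by move: c11; rewrite addnS -natr1; lra.
have k0 : 0 < k%:R :> R by rewrite ltr0n (leq_trans _ k10).
have kappa0 : 0 < kappa by apply: lt_le_trans kk.
have sR : 1 <= s%:R :> R by rewrite ler1n.
have qk : (2 ^ (3 * c1) * s ^ 3 <= q ^ k)%N.
  rewrite /k expnD; apply: leq_mul; last by apply: up_logP.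
  rewrite -[leqLHS]muln1 expnD leq_mul ?expn_gt0 ?(ltnW q1) //.
  by case: (3 * c1)%N => // l; rewrite leq_exp2r.
have L0 : 1 <= s%:R * kappa.
  rewrite -[leLHS]mulr1 ler_pM //; apply: le_trans kk.
  by rewrite ler1n (leq_trans _ k10).
(* If the least degree were larger, both terms of [covering_mass] would be at most 1/4, yet they sum
   to at least 1. *)
rewrite leNgt; apply/negP => big.
have := covering_mass dm ddeg dmult cover k10 (ltW C0) HC.
apply/negP; rewrite -ltNge.
have large : B * (s%:R ^+ 2 * (5 / 4 / q%:R) ^+ k) <= 1 / 4.
  have := tail_power_le R q1 qk; set W := (_ * _ ^+ k) => tW.
  have W0 : 0 <= W by rewrite mulr_ge0 ?exprn_ge0 // mulr_ge0 ?invr_ge0 //; lra.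
  have : 4 * B * W <= 4 ^+ c1 * W by rewrite ler_wpM2r.
  by lra.
set V := _ ^+ min_deg d.
(* [V] is [e^(N/k)] with [N > 3 kappa ln(s kappa)]; as [s kappa >= 1], replacing [kappa] by the
   smaller [k] is allowed. *)
have V3 : (s%:R * kappa) ^+ 3 <= V.
  rewrite /V -expRM_natl -[s%:R * kappa]lnK ?posrE ?mulr_gt0 ?(lt_le_trans _ sR) //.
  rewrite -expRM_natl ler_expR ler_pdivlMr //.
  apply: le_trans (ltW big); rewrite mulrAC ler_wpM2r ?ln_ge0 //.
  by rewrite ler_wpM2l.
have V0 : 0 < V by rewrite exprn_gt0 ?expR_gt0.
(* Of the three factors [kappa], two absorb [k^2] and the third absorbs [4 E]. *)
have small : V^-1 * (s%:R * (E * k%:R ^+ 2)) <= 1 / 4.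
  rewrite mulrC ler_pdivrMr //; apply: le_trans (_ : 1 / 4 * (s%:R * kappa) ^+ 3 <= _); last first.
    by rewrite ler_wpM2l //; lra.
  have -> : 1 / 4 * (s%:R * kappa) ^+ 3 = s%:R ^+ 3 * (1 / 4 * kappa * kappa ^+ 2) by field.
  apply: ler_pM => //; first by rewrite mulr_ge0 ?exprn_ge0 // ltW.
    by rewrite -[leLHS]expr1 ler_weXn2l.
  apply: ler_pM; rewrite ?exprn_ge0 ?(ltW E0) //; last by rewrite lerXn2r ?nnegrE // ltW.
  have := le_trans cE (_ : c <= kappa); rewrite lerDl mulr_ge0 // => /(_ isT); lra.
move: large small; rewrite -/B -/E; lra.
Qed.
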